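(* Let $d\ge 1$ and $n\ge 2d-1$. Then $$I_{\mathcal{M}_d,n}=(\mathrm{rad}\, I_{d+1,n}):J_{d,n}.$$ For $|\Sigma|=2$, also $$I_{\mathcal{H}_d,n}=(\mathrm{rad}\, I_{d+1,n}):J_{d,n}.$$
   Context: $\Sigma$ is a finite alphabet, $\Sigma^*$ the set of all finite strings over $\Sigma$ (including the empty string), $\Sigma^n$ the strings of length $n$, and $|v|$ the length of $v$. Matrix transposition is written $'$, and $\mathbf{1}=(1,\dots,1)'\in\mathbb{C}^d$. For matrices $(T_a)_{a\in\Sigma}$ and $v=a_1\cdots a_m$ write $T_v=T_{a_1}\cdots T_{a_m}$. Finitary model: $\mathcal{M}_d=\{((T_a)_{a\in\Sigma},\pi)\in(\mathbb{C}^{d\times d})^{\Sigma}\times\mathbb{C}^d \mid \sum_{a}T_a\mathbf{1}=\mathbf{1}\}$ and $\mathbf{f}_{\mathcal{M}_d,n}:\mathcal{M}_d\to\mathbb{C}^{\Sigma^n}$, $((T_a),\pi)\mapsto(\pi'T_v\mathbf{1})_{v\in\Sigma^n}$. Hidden Markov model: $\mathcal{H}_d=\{(M,E,\pi)\in\mathbb{C}^{d\times d}\times\mathbb{C}^{d\times\Sigma}\times\mathbb{C}^d \mid \sum_j m_{ij}=1,\ \sum_{a}e_{ia}=1 \text{ for all } i\}$ and $\mathbf{f}_{\mathcal{H}_d,n}:\mathcal{H}_d\to\mathbb{C}^{\Sigma^n}$, $(M,E,\pi)\mapsto(\pi'T_v\mathbf{1})_{v\in\Sigma^n}$ with $T_a=O_aM$,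 $O_a=\mathrm{diag}(e_{1a},\dots,e_{da})$. $R_n=\mathbb{C}[p_v\mid v\in\Sigma^n]$. $I_{\mathcal{M}_d,n}\subset R_n$ and $I_{\mathcal{H}_d,n}\subset R_n$ are the ideals of polynomials vanishing on the images of $\mathbf{f}_{\mathcal{M}_d,n}$ and $\mathbf{f}_{\mathcal{H}_d,n}$, respectively. For a string $u$ with $|u|=m<n$, the symbol $p_u$ denotes the element $\sum_{w\in\Sigma^{n-m}}p_{uw}$ of $R_n$. For integers $k,l\ge 0$ with $k+l\le n$, let $\mathcal{P}_{R,k,l}=[p_{vw}]_{|v|\le k,|w|\le l}$, the matrix over $R_n$ with rows indexed by all strings $v$ of length at most $k$ and columns by all strings $w$ of length at most $l$. Then: - $I_{d+1,n}\subset R_n$ is the ideal generated by all $(d+1)$-minors of $\mathcal{P}_{R,\lfloor n/2\rfloor,\lceil n/2\rceil}$ and all $(d+1)$-minors of $\mathcal{P}_{R,\lceil n/2\rceil,\lfloor n/2\rfloor}$; - $J_{d,n}\subset R_n$ is the ideal generated by all $d$-minors of $\mathcal{P}_{R,d-1,d-1}$. $\mathrm{rad}\,I$ is the radical of $I$, and $I:J=\{f\in R_n\mid fg\in I\ \text{for all } g\in J\}$ is the quotient ideal.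
   Formalization: The case of a one-letter alphabet with d ≥ 2 is excluded: there all d-minors of P_{R,d-1,d-1} vanish, so J_{d,n} = 0 and the quotient ideal is R_n, while I_{M_d,n} = 0, so the first equality fails. *)

(* Defs.v *)
From HB Require Import structures.
From mathcomp Require Import all_boot all_order all_algebra.
From mathcomp Require Import boolp classical_sets reals complex.
From mathcomp Require Import mpoly.

Set Implicit Arguments.
Unset Strict Implicit.
Unset Printing Implicit Defensive.

Import GRing.Theory.
Local Open Scope ring_scope.
Local Open Scope classical_set_scope.

Section Ideals.
Variable A : comNzRingType.
Implicit Types G I J : set A.

Definition ideal_gen G : set A :=
  [set f | exists (k : nat) (c g : 'I_k -> A),
     (forall i, G (g i)) /\ f = \sum_(i < k) c i * g i].

Definition radical I : set A :=
  [set f | exists2 m : nat, (0 < m)%N & I (f ^+ m)].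

Definition ideal_quotient I J : set A := [set f | forall g, J g -> I (f * g)].

(* Rows and columns may come in any order; reordering them only changes the
   sign of the determinant. *)
Definition minors (k p q : nat) (M : 'M[A]_(p, q)) : set A :=
  [set x | exists (r : 'I_k -> 'I_p) (c : 'I_k -> 'I_q),
     [/\ injective r, injective c & x = \det (mxsub r c M)]].

End Ideals.

Section WordPolynomials.
Variables (C : comNzRingType) (Sigma : finType) (n : nat).

Definition Rn : comNzRingType := {mpoly C[#|{: n.-tuple Sigma}|]}.

Definition pvar (v : n.-tuple Sigma) : Rn := 'X_(enum_rank v).

(* The words v of length n with prefix u are the u ++ w with w of length
   n - size u; if size u = n this is the indeterminate of u itself.
   Only meaningful for size u <= n. *)
Definition pword (u : seq Sigma) : Rn :=
  \sum_(v : n.-tuple Sigma | prefix u v) pvar v.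

Definition peval (x : n.-tuple Sigma -> C) (f : Rn) : C :=
  meval (fun i => x (enum_val i)) f.

Definition vanishing_ideal (S : set (n.-tuple Sigma -> C)) : set Rn :=
  [set f | forall x, S x -> peval x f = 0].

Definition hankel (k l : nat) :
    'M[Rn]_(#|{: k.-bseq Sigma}|, #|{: l.-bseq Sigma}|) :=
  \matrix_(i, j) pword (bseqval (enum_val i) ++ bseqval (enum_val j)).

(* The parameter r plays the role of d + 1. *)
Definition ideal_I (r : nat) : set Rn :=
  ideal_gen (minors r (hankel n./2 (uphalf n)) `|`
             minors r (hankel (uphalf n) n./2)).

Definition ideal_J (d : nat) : set Rn :=
  ideal_gen (minors d (hankel d.-1 d.-1)).

End WordPolynomials.

Arguments ideal_I : clear implicits.
Arguments ideal_J : clear implicits.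

Section Models.
Variables (C : comNzRingType) (Sigma : finType) (d n : nat).

Definition ones : 'cV[C]_d := const_mx 1.

Definition word_probs (T : Sigma -> 'M[C]_d) (pi : 'cV[C]_d) :
    n.-tuple Sigma -> C :=
  fun v => (pi^T *m (\prod_(a <- v) T a) *m ones) 0 0.

Definition finitary_model : set ((Sigma -> 'M[C]_d) * 'cV[C]_d) :=
  [set m : (Sigma -> 'M[C]_d) * 'cV[C]_d | \sum_a m.1 a *m ones = ones].

Definition finitary_map (m : (Sigma -> 'M[C]_d) * 'cV[C]_d) :
    n.-tuple Sigma -> C :=
  word_probs m.1 m.2.

Definition hidden_markov_model :
    set ('M[C]_d * ('I_d -> Sigma -> C) * 'cV[C]_d) :=
  [set h : 'M[C]_d * ('I_d -> Sigma -> C) * 'cV[C]_d |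
     (forall i, \sum_j h.1.1 i j = 1) /\ (forall i, \sum_a h.1.2 i a = 1)].

Definition hidden_markov_map
    (h : 'M[C]_d * ('I_d -> Sigma -> C) * 'cV[C]_d) : n.-tuple Sigma -> C :=
  let: (M, E, pi) := h in
  word_probs (fun a => diag_mx (\row_i E i a) *m M) pi.

Definition ideal_finitary : set (Rn C Sigma n) :=
  vanishing_ideal (finitary_map @` finitary_model).

Definition ideal_hidden_markov : set (Rn C Sigma n) :=
  vanishing_ideal (hidden_markov_map @` hidden_markov_model).

End Models.

Arguments ideal_finitary : clear implicits.
Arguments ideal_hidden_markov : clear implicits.

(* Main.v *)
From HB Require Import structures.
Require Import Defs.
From mathcomp Require Import all_boot all_order all_algebra.
From mathcomp Require Import boolp classical_sets reals complex.
From mathcomp Require Import mpoly generic_quotient ring_quotient zify.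

(* Put x_u = p_u modulo a prime P containing I_{d+1,n} but not some d-minor g of
   P_{d-1,d-1}, and let H be the d x d block with determinant g over the fraction
   field K of R_n / P.  As all (d+1)-minors vanish, x_{vw} = H_{v,C} H^-1 H_{R,w},
   so T_a = H^-1 H_{R,aC} realizes x as a point of the finitary model over K.
   The model is an affine space, hence a polynomial vanishing on its complex points
   vanishes on its K-points too; since the radical is an intersection of primes,
   I_M g lies in rad I_{d+1,n}, without any appeal to the Nullstellensatz.
   Conversely, the Hankel matrices of points of the model have rank at most d,
   and along the line joining a point to one where some d-minor of P_{d-1,d-1} is
   nonzero, that minor vanishes only finitely often, so f g = 0 forces f = 0.
   For two letters, a finitary model with S = T_0 + T_1 and T_0 = X S is
   conjugate to a hidden Markov model as soon as X is diagonalizable in a basis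
   whose vectors add up to the all-ones vector.  This holds up to arbitrarily
   small perturbations: make S invertible, then the all-ones vector cyclic for X,
   and then the eigenvalues of X distinct; in the Newton basis attached to the
   eigenvalues X is bidiagonal, so the last step only moves its diagonal. *)

Set Implicit Arguments.
Unset Strict Implicit.
Unset Printing Implicit Defensive.

Import GRing.Theory Num.Theory.
Local Open Scope ring_scope.
Local Open Scope quotient_scope.
Local Open Scope classical_set_scope.

(** * Prime ideals, their residue fields, and the radical *)

Section PrimeResidueField.
Variables (A : comNzRingType) (P : set A).
Hypotheses (P0 : P 0) (P1 : ~ P 1)
  (PD : forall x y, P x -> P y -> P (x + y))
  (PM : forall a x, P x -> P (a * x))
  (Pprime : forall x y, P (x * y) -> P x \/ P y).

Definition prime_pred : {pred A} := fun x => `[< P x >].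

Fact prime_pred_idealr : idealr_closed prime_pred.
Proof.
split=> [||a u v]; rewrite /in_mem /=; first exact/asboolP.
  exact/asboolP.
by move=> /asboolP Pu /asboolP Pv; apply/asboolP/PD => //; apply: PM.
Qed.
HB.instance Definition _ := isIdealr.Build A prime_pred prime_pred_idealr.

Fact prime_pred_prime : prime_idealr_closed prime_pred.
Proof.
move=> u v /asboolP /Pprime []; rewrite /in_mem /= => Px; apply/orP.
  by left; apply/asboolP.
by right; apply/asboolP.
Qed.
HB.instance Definition _ :=
  isPrimeIdealrClosed.Build A prime_pred prime_pred_prime.

Definition prime_quot := Quotient.quot prime_pred.
HB.instance Definition _ := GRing.ComNzRing.on prime_quot.

Definition pq_unit : {pred prime_quot} :=
  fun x => `[< exists y, y * x = 1 >].

(** [{fraction _}] asks for an integral domain with an inverse operation, so inverses are picked by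
    choice, with [x] itself as the default at nonunits. *)
Definition pq_inv (x : prime_quot) : prime_quot :=
  if pselect (exists y, y * x = 1) is left e then projT1 (cid e) else x.

Fact pq_mulVx : {in pq_unit, left_inverse 1 pq_inv *%R}.
Proof.
by move=> x /asboolP; rewrite /pq_inv; case: pselect => // e _; case: cid.
Qed.

Fact pq_unitPl (x y : prime_quot) : y * x = 1 -> pq_unit x.
Proof. by move=> e; apply/asboolP; exists y. Qed.

Fact pq_invr_out : {in [predC pq_unit], pq_inv =1 id}.
Proof.
move=> x nx; rewrite /pq_inv; case: pselect => // e.
by exfalso; move/negP: nx; apply; apply/asboolP.
Qed.

HB.instance Definition _ := GRing.ComNzRing_hasMulInverse.Build prime_quot
  pq_mulVx pq_unitPl pq_invr_out.

Fact pq_integral : GRing.integral_domain_axiom prime_quot.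
Proof. exact: Quotient.rquot_IdomainAxiom. Qed.

HB.instance Definition _ :=
  GRing.ComUnitRing_isIntegral.Build prime_quot pq_integral.

Definition to_residue_field : {rmorphism A -> {fraction prime_quot}} :=
  [the {rmorphism prime_quot -> {fraction prime_quot}} of @tofrac prime_quot]
  \o [the {rmorphism A -> prime_quot} of \pi_prime_quot].

Lemma to_residue_field_eq0 x : to_residue_field x = 0 <-> P x.
Proof.
have -> : (to_residue_field x = 0) <-> (\pi_prime_quot x = 0).
  rewrite /to_residue_field /=; split=> [/eqP|->]; last exact: tofrac0.
  by rewrite tofrac_eq0 => /eqP.
have -> : (\pi_prime_quot x = 0) <-> (prime_pred x).
  rewrite -[x in prime_pred x]subr0; split=> [e|].
    have := Quotient.idealrBE prime_pred x 0; rewrite /in_mem /= => ->.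
    by apply/eqP; rewrite e piE.
  have := Quotient.idealrBE prime_pred x 0; rewrite /in_mem /= => -> /eqP ->.
  by rewrite piE.
by split=> /asboolP.
Qed.

End PrimeResidueField.

(** If [a] is not in the radical, Zorn gives a maximal ideal among those containing [I] but no
    positive power of [a]. It is prime, and the map to its residue field kills [I] but not [a]. *)
Lemma radical_separation (A : comNzRingType) (I : set A) (a : A) :
    I 0 -> (forall x y, I x -> I y -> I (x + y)) ->
    (forall b x, I x -> I (b * x)) ->
    (forall (K : fieldType) (phi : {rmorphism A -> K}),
       (forall x, I x -> phi x = 0) -> phi a = 0) ->
  radical I a.
Proof.
move=> I0 ID IM Ia; apply: contrapT => nrad.
pose ideal (J : set A) := (forall x y, J x -> J y -> J (x + y)) /\
  (forall b x, J x -> J (b * x)).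
(* Ideals are of the form [X `|` I], so that the union of the empty chain is [I]. *)
pose good (X : set A) :=
  ideal (X `|` I) /\ forall m, (0 < m)%N -> ~ (X `|` I) (a ^+ m).
have [F Fgood Ftot|X [[[XD XM] Xa] Xmax]] := Zorn_bigcup (P := good).
  split; last first.
    move=> m m0 [[X FX Xm]|Im]; last by apply: nrad; exists m.
    by have [_ /(_ m m0)] := Fgood _ FX; apply; left.
  split=> [x y|b x]; last first.
    case=> [[X FX Xx]|Ix]; last by right; apply: IM.
    have [[_ XM] _] := Fgood _ FX.
    by have [|Xb|Ib] := XM b x; [left|left; exists X|right].
  have add2 X z t : F X -> (X `|` I) z -> (X `|` I) t ->
      (\bigcup_(X in F) X `|` I) (z + t).
    move=> FX Xz Xt; have [[XD _] _] := Fgood _ FX.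
    by have [|||] := XD z t => //; [left; exists X|right].
  case=> [[X FX Xx]|Ix] [[Y FY Yy]|Iy]; last by right; apply: ID.
  - have [XY|YX] := Ftot _ _ FX FY.
      by apply: (add2 Y) => //; left => //; apply: XY.
    by apply: (add2 X) => //; left => //; apply: YX.
  - by apply: (add2 X) => //; [left|right].
  - by apply: (add2 Y) => //; [right|left].
pose P := X `|` I.
have P0 : P 0 by right.
(* By maximality, the ideal generated by [P] and [x] contains a positive power of [a]. *)
have Pm x : ~ P x -> exists2 m, (0 < m)%N & exists b p, P p /\ a ^+ m = p + b * x.
  move=> nPx; pose Y : set A := [set y | exists b p, P p /\ y = p + b * x].
  have PY y : P y -> Y y by exists 0, y; rewrite mul0r addr0.
  have YI : Y `|` I = Y.
    by apply/seteqP; split=> [y [//|Iy]|y Yy]; [apply: PY; right|left].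
  apply: contrapT => nm; apply: (Xmax Y).
    split=> [y Xy|YX]; first by apply: PY; left.
    apply: nPx; left; apply: YX; exists 1, 0; split=> //.
    by rewrite add0r mul1r.
  rewrite /good YI; split; first split.
  - move=> y z [b [p [Pp ->]]] [c [q [Pq ->]]]; exists (b + c), (p + q).
    by split; [exact: XD|rewrite mulrDl addrACA].
  - move=> c y [b [p [Pp ->]]]; exists (c * b), (c * p).
    by split; [exact: XM|rewrite mulrDr mulrA].
  - by move=> m m0 [b [p [Pp e]]]; apply: nm; exists m => //; exists b, p.
have Pprime x y : P (x * y) -> P x \/ P y.
  move=> Pxy; apply: contrapT => /not_orP [/Pm [m m0 [b [p [Pp ep]]]]].
  move=> /Pm [k k0 [c [q [Pq eq]]]].
  (* In the product of the two expressions, three terms have a factor in [P] and the fourth has the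
     factor [x * y]. *)
  apply: (Xa (m + k)%N); first by rewrite addn_gt0 m0.
  rewrite exprD ep eq mulrDl mulrDr -addrA; apply: (XD); first exact: XM.
  apply: (XD); first by rewrite mulrC; apply: XM.
  by rewrite mulrDr; apply: (XD); [exact: XM|rewrite mulrACA; apply: XM].
have P1 : ~ P 1 by move=> P1; apply: (Xa 1%N) => //; rewrite -[a ^+ 1]mulr1; apply: XM.
apply: (Xa 1%N) => //; rewrite expr1 -/P.
apply/(to_residue_field_eq0 P0 P1 XD XM Pprime)/Ia => x Ix.
by apply/to_residue_field_eq0; right.
Qed.

(** * Polynomials determined by their values *)

Lemma rmorph_mmap (N : nat) (A B D : comNzRingType) (f : {rmorphism A -> B})
    (psi : {rmorphism B -> D}) (h : 'I_N -> B) (p : {mpoly A[N]}) :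
  psi (mmap f h p) = mmap (psi \o f) (psi \o h) p.
Proof.
rewrite /mmap rmorph_sum; apply: eq_bigr => m _.
rewrite rmorphM rmorph_prod; congr (_ * _).
by apply: eq_bigr => i _; rewrite rmorphXn.
Qed.

(** The product [p * q] has every natural number as a root, and these are distinct in characteristic
    zero. *)
Lemma poly_fun_eq0 (K : numDomainType) (p q : {poly K}) :
  q != 0 -> (forall s, q.[s] != 0 -> p.[s] = 0) -> p = 0.
Proof.
move=> q0 pq; have pq0 s : (p * q).[s] = 0.
  rewrite hornerM; have [->|/pq ->] := eqVneq q.[s] 0; first exact: mulr0.
  exact: mul0r.
suff /eqP : p * q = 0 by rewrite mulf_eq0 (negPf q0) orbF => /eqP.
apply/eqP; apply: contraT => nz.
have := @max_poly_roots _ (p * q) [seq i%:R | i <- iota 0 (size (p * q))] nz.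
rewrite size_map size_iota ltnn => -> //.
  by apply/allP => s _; apply/rootP.
rewrite map_inj_uniq ?iota_uniq // => i j /eqP.
by rewrite eqr_nat => /eqP.
Qed.

(** [muni] regards [p] as a polynomial in its last variable; reading off all coefficients shows that
    [muni p = 0] forces [p = 0]. *)
Lemma muni_coef (N : nat) (A : comNzRingType) (p : {mpoly A[N.+1]})
    (m : 'X_{1..N.+1}) :
  ((muni p)`_(m ord_max))@_[multinom m (widen_ord (leqnSn N) i) | i < N] = p@_m.
Proof.
rewrite muniE coef_sum [in RHS](mpolyE p) !raddf_sum /=; apply: eq_bigr => m' _.
rewrite coefZ coefXn mcoeffZ mcoeffX.
have [->|neq] := eqVneq m' m.
  by rewrite !eqxx /= mulr1 mcoeffZ mcoeffX eqxx.
have [emax|] := eqVneq (m ord_max) (m' ord_max); last by rewrite /= !mulr0 mcoeff0.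
rewrite mulr1 mcoeffZ mcoeffX; case: eqP => // /mnmP eqm; case/eqP: neq.
apply/mnmP => i; have [j ->|->] := unliftP ord_max i; last exact: esym.
have := eqm j; rewrite !mnmE.
by have -> : widen_ord (leqnSn N) j = lift ord_max j by apply: val_inj; rewrite /= /bump leqNgt ltn_ord.
Qed.

(** With the other variables fixed, the univariate polynomial in the last one vanishes everywhere,
    so its coefficients vanish at all fixed values and induction applies to them. *)
Lemma mpoly_fun_eq0 (K : numFieldType) (N : nat) (p : {mpoly K[N]}) :
  (forall v, meval v p = 0) -> p = 0.
Proof.
elim: N p => [|N IH] p p0.
  by have := p0 (fun=> 0); rewrite (nvar0_mpolyC p) mevalC => ->; rewrite mpolyC0.
suff mp0 : muni p = 0 by apply/mpolyP => m; rewrite -muni_coef mp0 coef0 !mcoeff0.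
apply/polyP => k; rewrite coef0; apply: IH => v.
rewrite -(coef_map (meval v)) /=.
suff -> : map_poly (meval v) (muni p) = 0 by rewrite coef0.
apply: (@poly_fun_eq0 _ _ 1) => [|s _]; first exact: oner_neq0.
rewrite muniE.
rewrite -(p0 (fun i => if unlift ord_max i is Some j then v j else s)).
rewrite mevalE rmorph_sum horner_sum /=; apply: eq_bigr => m _.
rewrite -mul_polyC rmorphM /= map_polyC map_polyXn hornerM hornerC hornerXn /=.
rewrite mevalZ -mulrA; congr (_ * _).
rewrite mevalX big_ord_recr /= unlift_none; congr (_ * _).
apply: eq_bigr => i _; rewrite mnmE.
have -> : widen_ord (leqnSn N) i = lift ord_max i by apply: val_inj; rewrite /= /bump leqNgt ltn_ord.
by rewrite liftK.
Qed.

(** * Word functions of matrix families and the elements p_u *)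

Section WordFunctions.
Variables (Sigma : finType) (d : nat).

(** Free end vectors and words of any length make room for prefixes, suffixes and changes of
    basis. *)
Definition word_fun (A : comNzRingType) (T : Sigma -> 'M[A]_d) (l : 'rV[A]_d)
    (r : 'cV[A]_d) (u : seq Sigma) : A :=
  (l *m (\prod_(a <- u) T a) *m r) 0 0.

Lemma map_mx_prod (A B : comNzRingType) (psi : {rmorphism A -> B})
    (T : Sigma -> 'M[A]_d) (u : seq Sigma) :
  map_mx psi (\prod_(a <- u) T a) = \prod_(a <- u) map_mx psi (T a).
Proof.
elim: u => [|a u IH]; first by rewrite !big_nil map_mx1.
by rewrite !big_cons -IH map_mxM.
Qed.

Lemma rmorph_word_fun (A B : comNzRingType) (psi : {rmorphism A -> B})
    (T : Sigma -> 'M[A]_d) l r u :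
  psi (word_fun T l r u) =
  word_fun (fun a => map_mx psi (T a)) (map_mx psi l) (map_mx psi r) u.
Proof. by rewrite /word_fun -map_mx_prod -!map_mxM [RHS]mxE. Qed.

Lemma word_fun_cat (A : comNzRingType) (T : Sigma -> 'M[A]_d) l r u w :
  word_fun T l r (u ++ w) =
  ((l *m \prod_(a <- u) T a) *m ((\prod_(a <- w) T a) *m r)) 0 0.
Proof. by rewrite /word_fun big_cat !mulmxA. Qed.

(** Replacing [r] by [(\sum_a T a) *m r] gives word functions the same marginalization rule as the
    p_u. *)
Lemma word_fun_rcons (A : comNzRingType) (T : Sigma -> 'M[A]_d) l r u :
  (\sum_a T a) *m r = r ->
  word_fun T l r u = \sum_a word_fun T l r (rcons u a).
Proof.
move=> Tr; rewrite /word_fun -[in LHS]Tr mulmx_suml mulmx_sumr summxE.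
apply: eq_bigr => a _; rewrite -cats1 big_cat big_seq1 /=.
by rewrite -[_ * _]/(_ *m _) !mulmxA.
Qed.

Lemma word_fun_conj (A : comNzRingType) (T T' : Sigma -> 'M[A]_d)
    (P : 'M[A]_d) l r u :
  (forall a, T a *m P = P *m T' a) ->
  word_fun T l (P *m r) u = word_fun T' (l *m P) r u.
Proof.
move=> TP; rewrite /word_fun -!mulmxA; congr ((l *m _) _ _).
elim: u => [|a u IH]; first by rewrite !big_nil !mul1mx.
by rewrite !big_cons -![_ * _]/(_ *m _) -!mulmxA IH mulmxA TP -mulmxA.
Qed.

End WordFunctions.

Section WordPolynomials.
Variables (Sigma : finType) (n : nat).

Lemma pword_full (A : comNzRingType) (v : n.-tuple Sigma) :
  pword A n v = pvar A v.
Proof.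
rewrite /pword (bigD1 v) ?prefix_refl //= big1 ?addr0 // => w /andP[vw wv].
case/eqP: wv; apply: val_inj => /=.
by move: vw; rewrite prefixE size_tuple -{1}(size_tuple w) take_size => /eqP.
Qed.

Lemma pword_rcons (A : comNzRingType) (u : seq Sigma) : (size u < n)%N ->
  pword A n u = \sum_a pword A n (rcons u a).
Proof.
move=> un; have [a0 _|none] := pickP (@predT Sigma); last first.
  (* Over the empty alphabet there is no word of length n > 0, and both sides are 0. *)
  rewrite [RHS]big1; last by move=> a; have := none a.
  rewrite /pword big1 // => -[[|a v] sv]; last by have := none a.
  by exfalso; move: un; rewrite -[in X in (_ < X)%N](eqP sv).
rewrite /pword (exchange_big_dep (fun v : n.-tuple Sigma => prefix u v)) /=; last first.
  by move=> a v _; rewrite -cats1; apply/prefix_trans/prefix_prefix.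
(* A word of length n that extends [u] counts for exactly one [a], its letter right after [u]. *)
apply: eq_bigr => v uv.
rewrite (big_pred1 (nth a0 v (size u))) // => a.
move: uv; rewrite !prefixE => /eqP uv.
rewrite size_rcons (take_nth a0) ?size_tuple // uv eqseq_rcons eqxx.
by rewrite andTb eq_sym.
Qed.

(** Marginalization determines both sides from the words of length n, by descending induction on the
    length of [u]. *)
Lemma word_extension (A : comNzRingType) (B : zmodType)
    (psi : {additive Rn A Sigma n -> B}) (W : seq Sigma -> B) :
  (forall v : n.-tuple Sigma, psi (pvar A v) = W v) ->
  (forall u, (size u < n)%N -> W u = \sum_a W (rcons u a)) ->
  forall u, (size u <= n)%N -> psi (pword A n u) = W u.
Proof.
move=> psiW Wr u; move: {2}(n - size u)%N (erefl (n - size u)%N) => k.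
elim: k u => [|k IH] u uk un.
  have su : size u == n by rewrite eqn_leq un -subn_eq0 uk.
  by rewrite -[u]/(val (Tuple su)) pword_full psiW.
have ult : (size u < n)%N by rewrite -subn_gt0 uk.
rewrite pword_rcons // raddf_sum Wr //; apply: eq_bigr => a _.
by apply: IH; rewrite size_rcons // subnS uk.
Qed.

HB.instance Definition _ (A : comNzRingType) (x : n.-tuple Sigma -> A) :=
  GRing.RMorphism.copy (@peval A Sigma n x) (meval (fun i => x (enum_val i))).

End WordPolynomials.

(** * Transfer of vanishing to points over larger rings *)

Section Transfer.
Variables (Sigma : finType) (d n : nat) (a0 : Sigma).

(** The coordinates of the parameter space: the entries of the matrices, then those of [pi]. *)
Definition param := (Sigma * 'I_d.+1 * 'I_d.+1 + 'I_d.+1)%type.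

(* The correction in the first column of [T a0] enforces the defining condition of
   the model without constraining the parameters [v]. *)
Definition gen_T (A : comNzRingType) (v : param -> A) (a : Sigma) :
    'M[A]_d.+1 :=
  \matrix_(i, j) (v (inl (a, i, j)) +
     if (a == a0) && (j == 0) then 1 - \sum_b \sum_k v (inl (b, i, k)) else 0).

Definition gen_pi (A : comNzRingType) (v : param -> A) : 'cV[A]_d.+1 :=
  \col_i v (inr i).

Lemma gen_T_ones (A : comNzRingType) (v : param -> A) :
  (\sum_a gen_T v a) *m ones A d.+1 = ones A d.+1.
Proof.
apply/colP => i; rewrite mxE [RHS]mxE.
under eq_bigr => j _ do rewrite summxE [ones _ _ _ _]mxE mulr1.
rewrite exchange_big /=.
under eq_bigr => a _ do under eq_bigr => j _ do rewrite mxE.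
under eq_bigr => a _ do rewrite big_split /=.
rewrite big_split /= [X in _ + X](bigD1 a0) //= [X in _ + (_ + X)]big1; last first.
  by move=> a /negPf na; rewrite big1 // => j _; rewrite na.
rewrite addr0 [X in _ + X](bigD1 0) //= !eqxx [X in _ + (_ + X)]big1; last first.
  by move=> j /negPf nj; rewrite nj.
by rewrite addr0 addrC subrK.
Qed.

Lemma gen_T_rmorph (A B : comNzRingType) (psi : {rmorphism A -> B}) v a :
  map_mx psi (gen_T v a) = gen_T (psi \o v) a.
Proof.
apply/matrixP => i j; rewrite !mxE rmorphD; congr (_ + _).
case: ifP => _; last exact: rmorph0.
rewrite rmorphB rmorph1 rmorph_sum; congr (_ - _).
by apply: eq_bigr => b _; rewrite rmorph_sum.
Qed.

Lemma gen_pi_rmorph (A B : comNzRingType) (psi : {rmorphism A -> B}) v :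
  map_mx psi (gen_pi v) = gen_pi (psi \o v).
Proof. by apply/matrixP => i j; rewrite !mxE. Qed.

(** The entries of the given point serve as parameters: its row sums make the correction term
    zero. *)
Lemma gen_onto (A : comNzRingType) (T : Sigma -> 'M[A]_d.+1) pi :
  (\sum_a T a) *m ones A d.+1 = ones A d.+1 ->
  exists v, T = gen_T v /\ pi = gen_pi v.
Proof.
move=> T1; exists (fun k => match k with inl (a, i, j) => T a i j | inr i => pi i 0 end).
split; last by apply/matrixP => i j; rewrite mxE ord1.
apply: funext => a; apply/matrixP => i j; rewrite mxE.
suff -> : \sum_b \sum_k T b i k = 1 by rewrite subrr if_same addr0.
transitivity (((\sum_a T a) *m ones A d.+1) i 0); last by rewrite T1 mxE.
rewrite mxE exchange_big; apply: eq_bigr => k _.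
by rewrite summxE mxE mulr1.
Qed.

End Transfer.

(** Let [F] be [f] at the generic point of the model, whose parameters are indeterminates. [F]
    vanishes at all values in [C], so it is the zero polynomial, and any point over [B] is a
    specialization of the generic one. *)
Lemma ideal_finitary_transfer (Sigma : finType) (d n : nat) (a0 : Sigma)
    (C : numFieldType) (B : comNzRingType)
    (iota : {rmorphism C -> B}) (f : Rn C Sigma n)
    (T : Sigma -> 'M[B]_d) (pi : 'cV[B]_d) :
  (0 < d)%N ->
  ideal_finitary C Sigma d n f ->
  (\sum_a T a) *m ones B d = ones B d ->
  mmap iota (fun i => word_probs T pi (enum_val i)) f = 0.
Proof.
case: d T pi => // d T pi _ If T1; have [v [-> ->]] := gen_onto a0 pi T1.
pose X (k : param Sigma d) : {mpoly C[#|{: param Sigma d}|]} := 'X_(enum_rank k).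
pose F := mmap (@mpolyC _ C)
  (fun i => word_probs (gen_T a0 X) (gen_pi X) (enum_val i)) f.
have wordE (D : comNzRingType) (psi : {rmorphism {mpoly C[#|{: param Sigma d}|]} -> D}) u :
    psi (word_probs (gen_T a0 X) (gen_pi X) u) =
    word_probs (gen_T a0 (psi \o X)) (gen_pi (psi \o X)) u :> D.
  rewrite [LHS]rmorph_word_fun -map_trmx gen_pi_rmorph map_const_mx rmorph1.
  by congr (word_fun _ _ _ _); apply: funext => a; apply: gen_T_rmorph.
have F0 : F = 0.
  apply: mpoly_fun_eq0 => w.
  rewrite rmorph_mmap -[RHS](If (word_probs (gen_T a0 (meval w \o X)) (gen_pi (meval w \o X)))).
    apply: eq_bigr => m _; rewrite /= mevalC; congr (_ * _).
    by apply: eq_bigr => i _; rewrite /= wordE.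
  exists (gen_T a0 (meval w \o X), gen_pi (meval w \o X)) => //.
  rewrite /finitary_model /=; rewrite -mulmx_suml; exact: gen_T_ones.
have e : mmap iota (fun i => v (enum_val i)) F = 0 by rewrite F0 mmap0.
rewrite -[RHS]e rmorph_mmap.
apply: eq_bigr => m _; rewrite /= mmapC; congr (_ * _).
apply: eq_bigr => i _; rewrite /= wordE.
have -> : mmap iota (fun i => v (enum_val i)) \o X = v; last by [].
by apply: funext => k; rewrite /= mmapX mmap1U enum_rankK.
Qed.

(** * Realizing a Hankel matrix of rank d *)

Lemma det_schur (K : fieldType) (p q : nat) (e : 'M[K]_p) (c : 'M_(p, q))
    (b : 'M_(q, p)) (H : 'M_q) : H \in unitmx ->
  \det (block_mx e c b H) = \det (e - c *m invmx H *m b) * \det H.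
Proof.
move=> uH; rewrite -(det_ublock _ c).
(* The second factor clears the block [b] by column operations. *)
have := det_mulmx (block_mx e c b H) (block_mx 1%:M 0 (- (invmx H *m b)) 1%:M).
rewrite det_lblock !det1 !mulr1 => <-; congr (\det _).
rewrite mulmx_block !mulmx1 !mulmx0 !add0r !mulmxN !mulmxA mulmxV //.
by rewrite mul1mx subrr.
Qed.

(** A rank one change of the identity at a nonzero coordinate of [t]. It serves to turn the final
    vector of a realization into the all-ones vector. *)
Lemma unitmx_ones (K : fieldType) (d : nat) (t : 'cV[K]_d) : t != 0 ->
  exists2 P, P \in unitmx & P *m ones K d = t.
Proof.
move=> /eqP t0; have [i ti] : exists i, t i 0 != 0.
  apply: contrapT => ti; apply: t0; apply/colP => i; rewrite mxE.
  by apply/eqP; apply: contrapT => /negP ?; apply: ti; exists i.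
pose u := t - ones K d; pose e : 'rV[K]_d := delta_mx 0 i.
have eu : e *m u = (t i 0 - 1)%:M.
  by apply/matrixP => j k; rewrite !ord1 -rowE !mxE /= mulr1n.
exists (1%:M + u *m e).
  (* The inverse is the Sherman-Morrison formula, where 1 + e u = t_i. *)
  have : (1%:M + u *m e) *m (1%:M - (t i 0)^-1 *: (u *m e)) = 1%:M.
    have uee : (1%:M + u *m e) *m (u *m e) = t i 0 *: (u *m e).
      rewrite mulmxDl mul1mx mulmxA -[u *m e *m u]mulmxA eu mul_mx_scalar.
      by rewrite -scalemxAl -[X in X + _]scale1r -scalerDl addrCA subrr addr0.
    by rewrite mulmxBr mulmx1 -scalemxAr uee scalerA mulVf // scale1r addrK.
  by move/mulmx1_unit => [].
rewrite mulmxDl mul1mx -mulmxA -rowE.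
have -> : row i (ones K d) = 1%:M.
  by apply/matrixP => j k; rewrite !ord1 !mxE /= mulr1n.
by rewrite mulmx1 addrC subrK.
Qed.

Section WordMatrices.
Variables (K : fieldType) (Sigma : finType).
Implicit Types (W : seq Sigma -> K).

Definition word_mx W p q (r : 'I_p -> seq Sigma) (c : 'I_q -> seq Sigma) :
    'M[K]_(p, q) :=
  \matrix_(i, j) W (r i ++ c j).

Definition const1 (v : seq Sigma) : 'I_1 -> seq Sigma := fun=> v.

(* The Hankel entry at (v, w) agrees with the rank d matrix determined by the rows
   [r] and the columns [c]. *)
Definition skeleton W d (r c : 'I_d -> seq Sigma) (v w : seq Sigma) : Prop :=
  W (v ++ w) = (word_mx W (const1 v) c *m invmx (word_mx W r c)
                *m word_mx W r (const1 w)) 0 0.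

Variables (n d : nat) (W : seq Sigma -> K) (r c : 'I_d -> seq Sigma).
Hypothesis H_unit : word_mx W r c \in unitmx.
Local Notation H := (word_mx W r c).

(** A row of [H] times its inverse is a unit vector. This covers the words of [r], which cannot be
    added as a new row to a minor. *)
Lemma skeleton_row i w : skeleton W r c (r i) w.
Proof.
rewrite /skeleton.
have -> : word_mx W (const1 (r i)) c = row i H.
  by apply/matrixP => k j; rewrite !mxE.
by rewrite -row_mul mulmxV // -row_mul mul1mx !mxE.
Qed.

Lemma skeleton_col j v : skeleton W r c v (c j).
Proof.
rewrite /skeleton.
have -> : word_mx W r (const1 (c j)) = col j H.
  by apply/matrixP => k l; rewrite !mxE.
by rewrite colE mulmxA -[_ *m invmx H *m H]mulmxA mulVmx // mulmx1 -colE !mxE.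
Qed.

Hypothesis W_sum : forall u, (size u < n)%N -> W u = \sum_a W (rcons u a).
Hypotheses (d_gt0 : (0 < d)%N) (dn : (2 * d - 1 <= n)%N)
  (r_size : forall i, (size (r i) < d)%N) (c_size : forall j, (size (c j) < d)%N).
Hypothesis skel : forall v w,
  (size v <= uphalf n)%N && (size w <= n./2)%N ||
  (size v <= n./2)%N && (size w <= uphalf n)%N -> skeleton W r c v w.

Definition skel_T a : 'M[K]_d := invmx H *m word_mx W r (fun j => a :: c j).

(** The skeleton identity for [v] against the words [a :: c j] moves the letter [a] from the row to
    the column side. *)
Lemma skel_row v a : (size v <= n./2)%N ->
  word_mx W (const1 (rcons v a)) c = word_mx W (const1 v) c *m skel_T a.
Proof.
move=> sv; apply/matrixP => i j; rewrite [LHS]mxE cat_rcons skel.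
  rewrite ord1 mulmxA [LHS]mxE [RHS]mxE; apply: eq_bigr => k _.
  by rewrite [X in _ * X = _]mxE [X in _ = _ * X]mxE.
(* [a :: c j] has length at most d, and 2d - 1 <= n gives d <= [uphalf n]. *)
by move: (c_size j); rewrite sv /=; lia.
Qed.

Lemma skel_col w a : (size w <= n./2)%N ->
  invmx H *m word_mx W r (const1 (a :: w)) =
  skel_T a *m (invmx H *m word_mx W r (const1 w)).
Proof.
move=> sw; rewrite /skel_T -!mulmxA; congr (_ *m _).
apply/matrixP => i j; rewrite [LHS]mxE -cat_rcons skel.
  rewrite ord1 -mulmxA [LHS]mxE [RHS]mxE; apply: eq_bigr => k _.
  by rewrite [X in X * _ = _]mxE [X in _ = X * _]mxE cat_rcons.
by move: (r_size i); rewrite sw size_rcons /=; lia.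
Qed.

Lemma skel_prefix v : (size v <= uphalf n)%N ->
  word_mx W (const1 v) c = word_mx W (const1 [::]) c *m \prod_(a <- v) skel_T a.
Proof.
elim/last_ind: v => [|v a IH]; first by rewrite big_nil mulmx1.
rewrite size_rcons => sv; rewrite skel_row; last by lia.
rewrite IH; last by lia.
by rewrite -cats1 big_cat big_seq1 /= -mulmxA.
Qed.

Lemma skel_suffix w : (size w <= uphalf n)%N ->
  invmx H *m word_mx W r (const1 w) =
  \prod_(a <- w) skel_T a *m (invmx H *m word_mx W r (const1 [::])).
Proof.
elim: w => [|a w IH]; first by rewrite big_nil mul1mx.
rewrite /= => sw; rewrite skel_col; last by lia.
by rewrite IH ?big_cons -?mulmxA //; lia.
Qed.

(** Cutting [v] at [n./2] leaves a suffix of length [uphalf n], so both halves stay within the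
    lengths covered by the minors. *)
Lemma skel_realization (v : n.-tuple Sigma) :
  W v = word_fun skel_T (word_mx W (const1 [::]) c)
          (invmx H *m word_mx W r (const1 [::])) v.
Proof.
rewrite -[in RHS](cat_take_drop n./2 v) word_fun_cat.
rewrite -skel_prefix -?skel_suffix ?mulmxA.
- rewrite -skel ?cat_take_drop //.
  by rewrite size_drop size_takel size_tuple; lia.
- by rewrite size_drop size_tuple; lia.
- by rewrite size_takel ?size_tuple; lia.
Qed.

(** Marginalization: the columns of the one-letter words add up to the column of the empty word. *)
Lemma skel_fixed :
  (\sum_a skel_T a) *m (invmx H *m word_mx W r (const1 [::])) =
  invmx H *m word_mx W r (const1 [::]).
Proof.
rewrite mulmx_suml; under eq_bigr => a _ do rewrite -skel_col //.
rewrite -mulmx_sumr; congr (_ *m _).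
apply/matrixP => i j; rewrite summxE [RHS]mxE cats0 W_sum.
  by apply: eq_bigr => a _; rewrite mxE cats1.
by move: (r_size i); lia.
Qed.

Lemma skel_finitary (a0 : Sigma) : exists T pi,
  (\sum_a T a) *m ones K d = ones K d /\
  forall v : n.-tuple Sigma, W v = word_probs T pi v.
Proof.
set t := invmx H *m word_mx W r (const1 [::]).
have [t0|/unitmx_ones [P uP Pt]] := eqVneq t 0.
  (* If t = 0, then [W] is zero on words of length n, and any point with [pi] = 0 realizes it. *)
  exists (fun a => if a == a0 then 1%:M else 0), 0; split=> [|v].
    rewrite -big_mkcond big_pred1_eq; exact: mul1mx.
  by rewrite skel_realization -/t t0 /word_fun mulmx0 /word_probs trmx0 !mul0mx.
exists (fun a => invmx P *m skel_T a *m P), (word_mx W (const1 [::]) c *m P)^T.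
split=> [|v].
  rewrite -mulmx_suml -mulmx_sumr -!mulmxA Pt skel_fixed -/t -Pt mulmxA.
  by rewrite mulVmx // mul1mx.
rewrite skel_realization -/t -Pt.
rewrite (word_fun_conj (T' := fun a => invmx P *m skel_T a *m P)) //.
  by rewrite /word_probs trmxK.
by move=> a; rewrite -!mulmxA mulKVmx.
Qed.

End WordMatrices.

(** * Generated ideals, Hankel minors, and the first inclusion *)

Section IdealGen.
Variables (A : comNzRingType) (G : set A).

Lemma ideal_gen0 : ideal_gen G 0.
Proof. by exists 0%N, (fun=> 0), (fun=> 0); split=> [[]|] //; rewrite big_ord0. Qed.

Lemma ideal_genD x y : ideal_gen G x -> ideal_gen G y -> ideal_gen G (x + y).
Proof.
move=> [k [c [g [Gg ->]]]] [l [b [h [Gh ->]]]].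
exists (k + l)%N, (fun i => match split i with inl j => c j | inr j => b j end),
  (fun i => match split i with inl j => g j | inr j => h j end).
split=> [i|]; first by case: (split i).
rewrite big_split_ord; congr (_ + _); apply: eq_bigr => i _.
  by rewrite (unsplitK (inl i)).
by rewrite (unsplitK (inr i)).
Qed.

Lemma ideal_genM b x : ideal_gen G x -> ideal_gen G (b * x).
Proof.
move=> [k [c [g [Gg ->]]]]; exists k, (fun i => b * c i), g; split=> //.
by rewrite mulr_sumr; apply: eq_bigr => i _; rewrite mulrA.
Qed.

Lemma sub_ideal_gen x : G x -> ideal_gen G x.
Proof. by move=> Gx; exists 1%N, (fun=> 1), (fun=> x); rewrite big_ord1 mul1r. Qed.

Lemma ideal_gen_kernel (B : comNzRingType) (phi : {rmorphism A -> B}) x :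
  (forall y, G y -> phi y = 0) -> ideal_gen G x -> phi x = 0.
Proof.
move=> phi0 [k [c [g [Gg ->]]]]; rewrite rmorph_sum big1 // => i _.
by rewrite rmorphM (phi0 _ (Gg i)) mulr0.
Qed.

End IdealGen.

Section HankelMinors.
Variables (K : fieldType) (C : comNzRingType) (Sigma : finType) (n : nat).
Variable phi : {rmorphism Rn C Sigma n -> K}.
Local Notation W := (fun u => phi (pword C n u)).

Lemma hankel_minor_word (m k l : nat) (r : 'I_m -> 'I_#|{: k.-bseq Sigma}|)
    (c : 'I_m -> 'I_#|{: l.-bseq Sigma}|) :
  phi (\det (mxsub r c (hankel C Sigma n k l))) =
  \det (word_mx W (fun i => bseqval (enum_val (r i)))
                  (fun j => bseqval (enum_val (c j)))).
Proof. by rewrite -det_map_mx; congr (\det _); apply/matrixP => i j; rewrite !mxE. Qed.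

Lemma word_minor_eq0 (m k l : nat) (r c : 'I_m -> seq Sigma) :
  (forall x, minors m (hankel C Sigma n k l) x -> phi x = 0) ->
  injective r -> injective c ->
  (forall i, (size (r i) <= k)%N) -> (forall i, (size (c i) <= l)%N) ->
  \det (word_mx W r c) = 0.
Proof.
move=> phi0 r_inj c_inj r_size c_size.
pose r' i := enum_rank (Bseq (r_size i)); pose c' i := enum_rank (Bseq (c_size i)).
have -> : \det (word_mx W r c) = phi (\det (mxsub r' c' (hankel C Sigma n k l))).
  rewrite hankel_minor_word; congr (\det _).
  by apply/matrixP => i j; rewrite !mxE !enum_rankK.
apply: phi0; exists r', c'; split=> // i j.
  by move=> /enum_rank_inj/(congr1 (@bseqval _ _)) /r_inj.
by move=> /enum_rank_inj/(congr1 (@bseqval _ _)) /c_inj.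
Qed.

(** Border the block [H] by the row [v] and the column [w]: this (d+1)-minor vanishes, and it is det
    H times a Schur complement, which is the defect of the identity. *)
Lemma skeleton_of_minors (d k l : nat) (r c : 'I_d -> seq Sigma) v w :
  (forall x, minors d.+1 (hankel C Sigma n k l) x -> phi x = 0) ->
  word_mx W r c \in unitmx -> injective r -> injective c ->
  (forall i, (size (r i) <= k)%N) -> (forall i, (size (c i) <= l)%N) ->
  (size v <= k)%N -> (size w <= l)%N ->
  skeleton W r c v w.
Proof.
move=> phi0 uH r_inj c_inj r_size c_size sv sw.
have [[i ->]|nv] := EM (exists i, v = r i); first exact: skeleton_row.
have [[j ->]|nw] := EM (exists j, w = c j); first exact: skeleton_col.
pose border (x : seq Sigma) (f : 'I_d -> seq Sigma) (i : 'I_(1 + d)) :=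
  match split i with inl _ => x | inr i => f i end.
have border_inj x f : injective f -> ~ (exists i, x = f i) ->
    injective (border x f).
  move=> f_inj nx i j; rewrite /border => e; apply: (can_inj (@splitK 1 d)); move: e.
  case: (split i) (split j) => [i'|i'] [j'|j'] => [_|e|e|/f_inj -> //].
  - by rewrite !ord1.
  - by case: nx; exists j'.
  - by case: nx; exists i'.
have border_size m x f : (size x <= m)%N -> (forall i, (size (f i) <= m)%N) ->
    forall i, (size (border x f i) <= m)%N.
  by move=> sx sf i; rewrite /border; case: (split i).
have det0 := word_minor_eq0 phi0 (border_inj _ _ r_inj nv) (border_inj _ _ c_inj nw)
  (border_size _ _ _ sv r_size) (border_size _ _ _ sw c_size).
have borderE : word_mx W (border v r) (border w c) =
    block_mx (word_mx W (const1 v) (const1 w)) (word_mx W (const1 v) c)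
             (word_mx W r (const1 w)) (word_mx W r c).
  apply/matrixP => i j; rewrite [LHS]mxE /border.
  by rewrite [RHS]mxE; case: (split i) => i'; rewrite [RHS]mxE;
    case: (split j) => j'; rewrite [RHS]mxE.
have := det_schur (word_mx W (const1 v) (const1 w)) (word_mx W (const1 v) c)
  (word_mx W r (const1 w)) uH.
rewrite -borderE det0 => /esym/eqP; rewrite mulf_eq0.
have /negPf -> : \det (word_mx W r c) != 0 by rewrite -unitfE -unitmxE.
rewrite orbF det_mx11 mxE [X in _ + X]mxE subr_eq0 => /eqP e.
by rewrite /skeleton -e mxE.
Qed.

End HankelMinors.

Lemma rmorph_mpolyE (A B : comNzRingType) (N : nat)
    (phi : {rmorphism {mpoly A[N]} -> B}) (p : {mpoly A[N]}) :
  phi p = mmap (phi \o @mpolyC N A) (fun i => phi 'X_i) p.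
Proof.
rewrite -[in LHS](comp_mpoly_id p) /comp_mpoly rmorph_mmap.
apply: eq_bigr => m _; congr (_ * _); apply: eq_bigr => i _.
by rewrite /= tnth_mktuple.
Qed.

Lemma finitary_sub_quotient (C : numFieldType) (Sigma : finType) (d n : nat)
    (a0 : Sigma) : (0 < d)%N -> (2 * d - 1 <= n)%N ->
  ideal_finitary C Sigma d n `<=`
  ideal_quotient (radical (ideal_I C Sigma n d.+1)) (ideal_J C Sigma n d).
Proof.
move=> d0 dn f If g Jg; apply: radical_separation.
- exact: ideal_gen0.
- exact: ideal_genD.
- exact: ideal_genM.
move=> K phi phi0; rewrite rmorphM.
(* If [phi f] is nonzero, an invertible d-minor would yield a realization over [K] and thus
   [phi f = 0]; hence all d-minors die. *)
suff [->|->] : phi f = 0 \/ phi g = 0; rewrite ?mul0r ?mulr0 //.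
apply: contrapT => /not_orP [f0]; apply.
apply: ideal_gen_kernel Jg => _ [r [c [r_inj c_inj ->]]].
apply: contrapT => /eqP; rewrite hankel_minor_word -unitfE => uH.
pose r' i := bseqval (enum_val (r i)); pose c' i := bseqval (enum_val (c i)).
have r'_inj : injective r' by move=> i j /val_inj/enum_val_inj/r_inj.
have c'_inj : injective c' by move=> i j /val_inj/enum_val_inj/c_inj.
have r'_size i : (size (r' i) <= d.-1)%N by apply: size_bseq.
have c'_size i : (size (c' i) <= d.-1)%N by apply: size_bseq.
have := @skel_finitary K Sigma n d (fun u => phi (pword C n u)) r' c'.
case=> //.
- by move=> u un; rewrite pword_rcons // rmorph_sum.
- by move=> i; rewrite (leq_ltn_trans (r'_size i)) // prednK.
- by move=> i; rewrite (leq_ltn_trans (c'_size i)) // prednK.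
- move=> v w /orP [] /andP [sv sw].
  + apply: (skeleton_of_minors (k := uphalf n) (l := n./2)) => //.
    * by move=> x mx; apply: phi0; apply: sub_ideal_gen; right.
    * by move=> i; rewrite (leq_trans (r'_size i)) //; lia.
    * by move=> i; rewrite (leq_trans (c'_size i)) //; lia.
  + apply: (skeleton_of_minors (k := n./2) (l := uphalf n)) => //.
    * by move=> x mx; apply: phi0; apply: sub_ideal_gen; left.
    * by move=> i; rewrite (leq_trans (r'_size i)) //; lia.
    * by move=> i; rewrite (leq_trans (c'_size i)) //; lia.
move=> T [pi [T1 Wpi]]; apply: f0.
(* [phi f] is [f] evaluated at the images of the variables, which form the realized point. *)
rewrite rmorph_mpolyE.
rewrite -[RHS](ideal_finitary_transfer a0
   (phi \o (@mpolyC _ C : {rmorphism C -> Rn C Sigma n})) pi d0 If T1).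
apply: eq_bigr => m _; congr (_ * _); apply: eq_bigr => i _.
by rewrite -Wpi pword_full /pvar enum_valK.
Qed.

(** * The quotient lies in the ideal of the finitary model *)

Lemma det_mulmx_rank (K : fieldType) (m p : nat) (A : 'M[K]_(m, p))
    (B : 'M_(p, m)) : (p < m)%N -> \det (A *m B) = 0.
Proof.
move=> pm; apply/eqP; apply: contraTT pm; rewrite -unitfE -unitmxE -row_free_unit.
rewrite /row_free -leqNgt => /eqP <-.
exact: leq_trans (mxrankM_maxl _ _) (rank_leq_col _).
Qed.

Section FinitaryPoints.
Variables (K : fieldType) (Sigma : finType) (d n : nat).
Variables (T : Sigma -> 'M[K]_d) (pi : 'cV[K]_d).
Hypothesis T1 : (\sum_a T a) *m ones K d = ones K d.

Lemma peval_pword u : (size u <= n)%N ->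
  peval (@word_probs K Sigma d n T pi) (pword K n u) = word_fun T pi^T (ones K d) u.
Proof.
apply: (@word_extension Sigma n K K (peval (word_probs T pi))).
  by move=> v; rewrite /= /peval /pvar mevalXU enum_rankK.
by move=> w _; apply: word_fun_rcons.
Qed.

(** The entry at (v, w) pairs the row vector pi' T_v with the column vector T_w 1, so the matrix
    factors through [K^d]. *)
Lemma peval_hankel_minor (m k l : nat) (r : 'I_m -> 'I_#|{: k.-bseq Sigma}|)
    (c : 'I_m -> 'I_#|{: l.-bseq Sigma}|) : (k + l <= n)%N ->
  peval (@word_probs K Sigma d n T pi) (\det (mxsub r c (hankel K Sigma n k l))) =
  \det ((\matrix_i (pi^T *m \prod_(a <- enum_val (r i)) T a)) *m
        (\matrix_j ((\prod_(a <- enum_val (c j)) T a) *m ones K d)^T)^T).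
Proof.
move=> kl; rewrite hankel_minor_word; congr (\det _).
apply/matrixP => i j; rewrite [LHS]mxE /= peval_pword; last first.
  rewrite size_cat; apply: leq_trans kl; apply: leq_add; exact: size_bseq.
rewrite word_fun_cat mxE [RHS]mxE; apply: eq_bigr => k' _.
by congr (_ * _); rewrite ?mxE.
Qed.

Lemma peval_ideal_I f : ideal_I K Sigma n d.+1 f ->
  peval (@word_probs K Sigma d n T pi) f = 0.
Proof.
apply: (ideal_gen_kernel (phi := peval (word_probs T pi))).
by move=> _ [] [r [c [_ _ ->]]]; rewrite /= peval_hankel_minor;
  rewrite ?det_mulmx_rank //; lia.
Qed.

End FinitaryPoints.

Section Paths.
Variables (K : numFieldType) (Sigma : finType) (d n : nat).

Definition path_poly (T : Sigma -> 'M[{poly K}]_d) (pi : 'cV[{poly K}]_d)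
    (f : Rn K Sigma n) : {poly K} :=
  mmap polyC (fun i => word_probs T pi (enum_val i)) f.

Lemma horner_path_poly T pi f s :
  (path_poly T pi f).[s] =
  peval (word_probs (fun a => map_mx (horner_eval s) (T a))
                    (map_mx (horner_eval s) pi)) f.
Proof.
rewrite -[LHS]/(horner_eval s _) rmorph_mmap.
apply: eq_bigr => m _; rewrite /= /horner_eval hornerC; congr (_ * _).
apply: eq_bigr => i _; congr (_ ^+ _).
rewrite -[LHS]/(horner_eval s _) [LHS]rmorph_word_fun.
by rewrite -map_trmx map_const_mx rmorph1.
Qed.

Implicit Types (T : Sigma -> 'M[{poly K}]_d) (pi : 'cV[{poly K}]_d).

(** The pullback of [f] to the path is a polynomial in one variable that vanishes off the finitely
    many roots of [q]. This replaces limits in every perturbation below. *)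
Lemma path_closed T pi (f : Rn K Sigma n) (q : {poly K}) : q != 0 ->
  (forall s, q.[s] != 0 ->
     peval (word_probs (fun a => map_mx (horner_eval s) (T a))
                       (map_mx (horner_eval s) pi)) f = 0) ->
  forall s, peval (word_probs (fun a => map_mx (horner_eval s) (T a))
                              (map_mx (horner_eval s) pi)) f = 0.
Proof.
move=> q0 f0 s; suff p0 : path_poly T pi f = 0 by rewrite -horner_path_poly p0 horner0.
by apply: (poly_fun_eq0 q0) => t /f0; rewrite horner_path_poly.
Qed.

Definition line_mx p q (A B : 'M[K]_(p, q)) : 'M[{poly K}]_(p, q) :=
  map_mx polyC A + 'X *: map_mx polyC (B - A).

Lemma horner_line_mx p q (A B : 'M[K]_(p, q)) s :
  map_mx (horner_eval s) (line_mx A B) = A + s *: (B - A).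
Proof.
by apply/matrixP => i j; rewrite !mxE /horner_eval !hornerE.
Qed.

Lemma horner_line_mx0 p q (A B : 'M[K]_(p, q)) :
  map_mx (horner_eval 0) (line_mx A B) = A.
Proof. by rewrite horner_line_mx scale0r addr0. Qed.

Lemma horner_line_mx1 p q (A B : 'M[K]_(p, q)) :
  map_mx (horner_eval 1) (line_mx A B) = B.
Proof. by rewrite horner_line_mx scale1r addrC subrK. Qed.

End Paths.

Section Witness.
Variables (K : numFieldType) (Sigma : finType) (d n : nat) (a0 a1 : Sigma).
Hypothesis a01 : a1 != a0 \/ d = 1%N.

(** Distinct values; starting at 1 lets a single letter suffice for the witness when d = 1. *)
Definition nodes : 'rV[K]_d := \row_i i.+1%:R.

Definition witness_T (a : Sigma) : 'M[K]_d :=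
  if a == a0 then diag_mx nodes else if a == a1 then 1%:M - diag_mx nodes else 0.

Lemma witness_finitary : (\sum_a witness_T a) *m ones K d = ones K d.
Proof.
rewrite (bigD1 a0) //= {1}/witness_T eqxx.
case: (eqVneq a1 a0) a01 => [e|ne] H.
  rewrite big1 => [|a /negPf na]; last by rewrite /witness_T e na.
  have d1 : d = 1%N by case: H.
  rewrite addr0; suff -> : nodes = const_mx 1 by rewrite diag_const_mx mul1mx.
  apply/rowP => i; rewrite !mxE; case: i => -[//|i] /=; by rewrite d1.
rewrite (bigD1 a1) //= {1}/witness_T (negPf ne) eqxx big1 ?addr0.
  by rewrite addrC subrK mul1mx.
by move=> a /andP [/negPf na0 /negPf na1]; rewrite /witness_T na0 na1.
Qed.

Lemma Vandermonde_nodes_unit : Vandermonde d nodes \in unitmx.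
Proof.
rewrite unitmxE det_Vandermonde unitfE; apply/prodf_neq0 => i _.
apply/prodf_neq0 => j ij; rewrite !mxE subr_eq0 eqr_nat eqSS.
by rewrite eq_sym neq_ltn ij.
Qed.

(** On the words [nseq i a0] with i < d the Hankel block is a Vandermonde matrix times its
    transpose. *)
Lemma witness_minor : (2 * d - 1 <= n)%N ->
  exists2 g, ideal_J K Sigma n d g &
    peval (word_probs witness_T (ones K d)) g != 0.
Proof.
move=> dn.
have sz (i : 'I_d) : (size (nseq i a0) <= d.-1)%N.
  by rewrite size_nseq; move: (ltn_ord i); lia.
pose r i := enum_rank (Bseq (sz i)).
have r_inj : injective r.
  move=> i j /enum_rank_inj/(congr1 (@bseqval _ _))/(congr1 size) /=.
  by rewrite !size_nseq => /val_inj.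
exists (\det (mxsub r r (hankel K Sigma n d.-1 d.-1))).
  by apply: sub_ideal_gen; exists r, r.
rewrite peval_hankel_minor; [|exact: witness_finitary|lia].
have prodE (i : 'I_d) : \prod_(a <- enum_val (r i)) witness_T a =
    diag_mx (\row_j (nodes 0 j ^+ i)).
  rewrite /r enum_rankK /=; elim: (i : nat) => [|k IH].
    rewrite big_nil; by apply/matrixP => x y; rewrite !mxE expr0.
  rewrite big_cons IH /witness_T eqxx -[_ * _]/(_ *m _) mulmx_diag.
  by congr diag_mx; apply/rowP => j; rewrite !mxE exprS.
have e1 : \matrix_i ((ones K d)^T *m \prod_(a <- enum_val (r i)) witness_T a) =
    Vandermonde d nodes.
  by apply/matrixP => i j; rewrite mxE prodE mul_mx_diag !mxE mul1r.
have e2 : \matrix_j ((\prod_(a <- enum_val (r j)) witness_T a) *m ones K d)^T =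
    Vandermonde d nodes.
  by apply/matrixP => i j; rewrite mxE prodE mul_diag_mx !mxE mulr1.
rewrite e1 e2 det_mulmx det_tr mulf_neq0 // -unitfE -unitmxE;
  exact: Vandermonde_nodes_unit.
Qed.

End Witness.

(** The line from the witness at 0 to the given point at 1 stays in the model, whose condition is
    affine. There a power of [f * g] vanishes, hence so does [f] wherever [g] does not, and [g] is
    nonzero at 0. *)
Lemma quotient_sub_finitary (K : numFieldType) (Sigma : finType) (d n : nat)
    (a0 a1 : Sigma) : a1 != a0 \/ d = 1%N -> (2 * d - 1 <= n)%N ->
  ideal_quotient (radical (ideal_I K Sigma n d.+1)) (ideal_J K Sigma n d) `<=`
  ideal_finitary K Sigma d n.
Proof.
move=> a01 dn f fJ _ [[T pi] /= Tfin <-].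
have [g Jg g0] := witness_minor K a01 dn.
have [m m0 fgI] := fJ g Jg.
have Tfin' : (\sum_a T a) *m ones K d = ones K d by rewrite mulmx_suml.
pose TT a := line_mx (witness_T K d a0 a1 a) (T a).
pose PP := line_mx (ones K d) pi.
have TTfin s : (\sum_a map_mx (horner_eval s) (TT a)) *m ones K d = ones K d.
  under eq_bigr => a _ do rewrite horner_line_mx.
  rewrite big_split /= -scaler_sumr sumrB mulmxDl -scalemxAl mulmxBl.
  by rewrite witness_finitary // Tfin' subrr scaler0 addr0.
have := @path_closed K Sigma d n TT PP f (path_poly TT PP g).
have TT0 : (fun a => map_mx (horner_eval 0) (TT a)) = witness_T K d a0 a1.
  by apply: funext => a; rewrite horner_line_mx0.
have TT1 : (fun a => map_mx (horner_eval 1) (TT a)) = T.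
  by apply: funext => a; rewrite horner_line_mx1.
move=> /(_ _ _ 1); rewrite TT1 horner_line_mx1; apply.
  apply: contraNneq g0 => /(congr1 (horner_eval 0)).
  by rewrite /horner_eval horner_path_poly horner0 TT0 horner_line_mx0 => ->.
move=> s; rewrite horner_path_poly => gs.
have := peval_ideal_I (map_mx (horner_eval s) PP) (TTfin s) fgI.
rewrite rmorphXn rmorphM => /eqP; rewrite expf_eq0 m0 mulf_eq0 /=.
by rewrite (negPf gs) orbF => /eqP.
Qed.

Lemma finitary_sub_hidden_markov (C : comNzRingType) (Sigma : finType) (d n : nat) :
  ideal_finitary C Sigma d n `<=` ideal_hidden_markov C Sigma d n.
Proof.
move=> f If _ [[[M E] pi] [/= M1 E1] <-]; apply: If.
exists (fun a => diag_mx (\row_i E i a) *m M, pi) => //=.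
have Mones : M *m ones C d = ones C d.
  apply/colP => i; rewrite mxE [RHS]mxE -[RHS](M1 i).
  by apply: eq_bigr => j _; rewrite mxE mulr1.
rewrite /finitary_model /=; under eq_bigr => a _ do rewrite -mulmxA Mones.
apply/colP => i; rewrite summxE [RHS]mxE -[RHS](E1 i).
by apply: eq_bigr => a _; rewrite mul_diag_mx !mxE mulr1.
Qed.

(** * Newton bases and cyclic vectors *)

Section NewtonBasis.
Variable (d : nat).

(* Multiplication by 'X in the Newton basis with nodes [lam]; the rows of
   [newton_mx lam] are its left eigenvectors. *)
Definition bidiag_mx (A : comNzRingType) (lam : 'rV[A]_d) : 'M[A]_d :=
  diag_mx lam + \matrix_(i, j) (i == j.+1 :> nat)%:R.

Definition newton_mx (A : comNzRingType) (lam : 'rV[A]_d) : 'M[A]_d :=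
  \matrix_(i, k) \prod_(j < d | (j < k)%N) (lam 0 i - lam 0 j).

Lemma map_bidiag_mx (A B : comNzRingType) (psi : {rmorphism A -> B}) lam :
  map_mx psi (bidiag_mx lam) = bidiag_mx (map_mx psi lam).
Proof.
rewrite /bidiag_mx map_mxD map_diag_mx; congr (_ + _).
by apply/matrixP => i j; rewrite !mxE; apply: (rmorph_nat psi).
Qed.

Lemma map_newton_mx (A B : comNzRingType) (psi : {rmorphism A -> B}) lam :
  map_mx psi (newton_mx lam) = newton_mx (map_mx psi lam).
Proof.
apply/matrixP => i j; rewrite !mxE rmorph_prod.
by apply: eq_bigr => k _; rewrite rmorphB !mxE.
Qed.

(** With N_k the Newton polynomials, this is lam_i N_k(lam_i) = lam_k N_k(lam_i) +
    N_(k+1)(lam_i). *)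
Lemma newton_bidiag (A : comNzRingType) (lam : 'rV[A]_d) :
  newton_mx lam *m bidiag_mx lam = diag_mx lam *m newton_mx lam.
Proof.
apply/matrixP => i k; rewrite mulmxDr mul_mx_diag mul_diag_mx !mxE.
have step : \prod_(j < d | (j < k.+1)%N) (lam 0 i - lam 0 j) =
    (lam 0 i - lam 0 k) * \prod_(j < d | (j < k)%N) (lam 0 i - lam 0 j).
  rewrite (bigD1 k) //=; congr (_ * _); apply: eq_bigl => j.
  by rewrite ltnS andbC ltn_neqAle.
suff -> : \sum_j newton_mx lam i j * (\matrix_(i, j) (i == j.+1 :> nat)%:R) j k =
    (lam 0 i - lam 0 k) * \prod_(j < d | (j < k)%N) (lam 0 i - lam 0 j) :> A.
  by rewrite [_ * lam 0 k]mulrC -mulrDl addrC subrK.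
rewrite -step.
case: (ltnP k.+1 d) => kd.
  rewrite (bigD1 (Ordinal kd)) //= !mxE eqxx mulr1 [X in _ + X]big1 ?addr0 // => j.
  by rewrite [X in _ * X]mxE -val_eqE /= => /negPf ->; rewrite mulr0.
rewrite [LHS]big1 => [|j _]; last first.
  rewrite [X in _ * X]mxE ltn_eqF ?mulr0 //.
  exact: leq_trans (ltn_ord j) kd.
(* For the last k there is no next column, and the product vanishes by its factor at j = i. *)
have ik : (i < k.+1)%N by apply: leq_trans kd.
by rewrite [RHS](bigD1 i ik) /= subrr mul0r.
Qed.

Lemma det_newton (A : comNzRingType) (lam : 'rV[A]_d) :
  \det (newton_mx lam) =
  \prod_(i < d) \prod_(j < d | (j < i)%N) (lam 0 i - lam 0 j).
Proof.
rewrite det_trig; first by apply: eq_bigr => i _; rewrite mxE.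
apply/is_trig_mxP => i j ij; rewrite mxE (bigD1 i) //=.
by rewrite subrr mul0r.
Qed.

End NewtonBasis.

(** The first Newton polynomial is 1. Hence the columns of the inverse, which are eigenvectors of
    [bidiag_mx lam], add up to the first basis vector. *)
Lemma newton_mx0 (A : comNzRingType) (d : nat) (lam : 'rV[A]_d.+1) :
  newton_mx lam *m delta_mx 0 0 = ones A d.+1.
Proof.
by apply/matrixP => i j; rewrite !ord1 -colE !mxE big_pred0.
Qed.

Section Krylov.
Variable d : nat.

(** Invertible exactly when the all-ones vector is cyclic for [X]. *)
Definition krylov_mx (A : comNzRingType) (X : 'M[A]_d.+1) : 'M[A]_d.+1 :=
  \matrix_(i, k) (X ^+ k *m ones A d.+1) i 0.

Lemma map_krylov_mx (A B : comNzRingType) (psi : {rmorphism A -> B}) X :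
  map_mx psi (krylov_mx X) = krylov_mx (map_mx psi X).
Proof.
apply/matrixP => i k; rewrite !mxE rmorph_sum; apply: eq_bigr => j _.
by rewrite rmorphM -rmorphXn /= !mxE rmorph1.
Qed.

Lemma krylov_diag (A : comNzRingType) (lam : 'rV[A]_d.+1) :
  krylov_mx (diag_mx lam) = (Vandermonde d.+1 lam)^T.
Proof.
apply/matrixP => i k; rewrite !mxE.
have -> : diag_mx lam ^+ k = diag_mx (\row_j lam 0 j ^+ k).
  elim: (k : nat) => [|m IH].
    by apply/matrixP => x y; rewrite expr0 !mxE expr0.
  rewrite exprS IH -[_ * _]/(_ *m _) mulmx_diag.
  by congr diag_mx; apply/rowP => j; rewrite !mxE exprS.
transitivity ((diag_mx (\row_j lam 0 j ^+ k) *m ones A d.+1) i 0); first by rewrite mxE.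
by rewrite mul_diag_mx !mxE mulr1.
Qed.

(* The columns of [Q] are the images of the all-ones vector under the Newton
   polynomials prod_(j < k) ('X - lam_j) in X. *)
Lemma cyclic_bidiag (K : fieldType) (X : 'M[K]_d.+1) (lam : 'rV[K]_d.+1) :
  char_poly X = \prod_i ('X - (lam 0 i)%:P) ->
  krylov_mx X \in unitmx ->
  exists Q, [/\ Q \in unitmx, Q *m delta_mx 0 0 = ones K d.+1
              & X *m Q = Q *m bidiag_mx lam].
Proof.
move=> chX uX.
pose q (k : nat) := \prod_(j < d.+1 | (j < k)%N) ('X - (lam 0 j)%:P).
pose b k := horner_mx X (q k) *m ones K d.+1.
have qS (k : 'I_d.+1) : q k.+1 = ('X - (lam 0 k)%:P) * q k.
  rewrite /q (bigD1 k) //=; congr (_ * _); apply: eq_bigl => j.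
  by rewrite ltnS andbC ltn_neqAle.
have q_monic k : q k \is monic by apply: monic_prod => j _; apply: monicXsubC.
have size_q (k : nat) : (k <= d.+1)%N -> size (q k) = k.+1.
  elim: k => [|k IH] kd; first by rewrite /q big_pred0 // size_poly1.
  rewrite (qS (Ordinal kd)) size_monicM ?monicXsubC ?monic_neq0 //.
  by rewrite size_XsubC IH // ltnW.
have qd : q d.+1 = char_poly X.
  by rewrite chX; apply: eq_bigl => j; rewrite ltn_ord.
have b_step (k : 'I_d.+1) : X *m b k = lam 0 k *: b k + b k.+1.
  rewrite /b qS rmorphM rmorphB /= horner_mx_X horner_mx_C.
  rewrite -[_ * _]/(_ *m _) mulmxBl mul_scalar_mx mulmxBl -!mulmxA.
  by rewrite scalemxAl addrC subrK.
pose Q := \matrix_(i, k < d.+1) b k i 0.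
(* [U] passes from powers of [X] to Newton polynomials; it is unitriangular as [q k] is monic of
   degree k. *)
pose U := \matrix_(j, k < d.+1) (q k)`_j.
have QU : Q = krylov_mx X *m U.
  apply/matrixP => i k; rewrite mxE [RHS]mxE /b.
  have -> : q k = \sum_(j < d.+1) (q k)`_j *: 'X^j.
    rewrite -poly_def; apply/polyP => j; rewrite coef_poly; case: ltnP => // dj.
    by rewrite nth_default // size_q ?(leq_trans (ltn_ord k)) // ltnW.
  rewrite rmorph_sum mulmx_suml summxE; apply: eq_bigr => j _.
  rewrite /= horner_mxZ rmorphXn /= horner_mx_X -scalemxAl [LHS]mxE mulrC.
  by rewrite [X in _ = X * _]mxE [X in _ = _ * X]mxE.
exists Q; split.
- rewrite QU unitmx_mul uX /= unitmxE -det_tr det_trig.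
    rewrite big1 ?unitr1 // => i _; rewrite !mxE.
    by have /monicP := q_monic i; rewrite lead_coefE size_q // ltnW.
  apply/is_trig_mxP => i j ij; rewrite !mxE nth_default //.
  by rewrite size_q // ltnW.
- apply/matrixP => i j; rewrite !ord1 -colE [LHS]mxE [LHS]mxE /b /q big_pred0 //.
  by rewrite rmorph1 mul1mx.
- apply/matrixP => i k.
  transitivity ((lam 0 k *: b k + b k.+1) i 0).
    rewrite -b_step [LHS]mxE [RHS]mxE; apply: eq_bigr => j _.
    by rewrite [X in _ * X = _]mxE.
  rewrite mulmxDr [LHS]mxE [RHS]mxE; congr (_ + _).
    by rewrite mul_mx_diag [LHS]mxE [RHS]mxE mulrC; congr (_ * _); rewrite [RHS]mxE.
  rewrite [RHS]mxE.
  case: (ltnP k.+1 d.+1) => kd.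
    rewrite (bigD1 (Ordinal kd)) //= big1 => [|j].
      by rewrite [X in X * _]mxE [X in _ * X]mxE /= eqxx mulr1 addr0.
    by rewrite [X in _ * X]mxE -val_eqE /= => /negPf ->; rewrite mulr0.
  have ek : k.+1 = d.+1 by apply/eqP; rewrite eqn_leq kd ltn_ord.
  (* After the last column comes the characteristic polynomial at [X], which is 0. *)
  rewrite ek /b qd Cayley_Hamilton mul0mx mxE big1 // => j _.
  by rewrite [X in _ * X]mxE ek ltn_eqF ?mulr0.
Qed.

End Krylov.

(** * Two letters: approximating by hidden Markov models *)

Section TwoLetters.
Variables (Sigma : finType) (a0 a1 : Sigma).
Hypotheses (a01 : a1 != a0) (a01P : forall a, a = a0 \/ a = a1).

(** In terms of the sum [S], the condition of the model concerns [S] alone and [Y] is free. *)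
Definition pair_T (A : comNzRingType) d (Y S : 'M[A]_d) (a : Sigma) : 'M[A]_d :=
  if a == a0 then Y else S - Y.

Lemma map_pair_T (A B : comNzRingType) (psi : {rmorphism A -> B}) d (Y S : 'M[A]_d) a :
  map_mx psi (pair_T Y S a) = pair_T (map_mx psi Y) (map_mx psi S) a.
Proof. by rewrite /pair_T; case: ifP => // _; rewrite map_mxB. Qed.

Lemma sum_letters (V : zmodType) (F : Sigma -> V) : \sum_a F a = F a0 + F a1.
Proof.
rewrite (bigD1 a0) //= (bigD1 a1) //= big1 ?addr0 // => a /andP [n0 n1].
by case: (a01P a) => e; move: n0 n1; rewrite e eqxx.
Qed.

Variables (d n : nat).

Section Field.
Variables (K : fieldType) (f : Rn K Sigma n).
Hypothesis If : ideal_hidden_markov K Sigma d n f.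

(** In the basis [P], [S] becomes the transition matrix and [X] the emission matrix of [a0]; as [P]
    fixes the all-ones vector, row sums remain 1. *)
Lemma hidden_markov_conj (P X S : 'M[K]_d) (lam : 'rV_d) (pi : 'cV_d) :
  P \in unitmx -> P *m ones K d = ones K d -> S *m ones K d = ones K d ->
  X *m P = P *m diag_mx lam ->
  peval (word_probs (pair_T (X *m S) S) pi) f = 0.
Proof.
move=> uP P1 S1 XP.
pose M := invmx P *m S *m P.
pose E i a := if a == a0 then lam 0 i else 1 - lam 0 i.
have M1 : M *m ones K d = ones K d.
  by rewrite -!mulmxA P1 S1 -{1}P1 mulmxA mulVmx // mul1mx.
have -> : word_probs (pair_T (X *m S) S) pi =
    hidden_markov_map (M, E, P^T *m pi) :> (n.-tuple Sigma -> K).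
  apply: funext => v.
  rewrite -[LHS]/(word_fun (pair_T (X *m S) S) pi^T (ones K d) v) -{1}P1.
  rewrite (word_fun_conj (T' := fun a => diag_mx (\row_i E i a) *m M)).
    by rewrite /hidden_markov_map /word_probs trmx_mul trmxK.
  have PM : P *m M = S *m P by rewrite /M !mulmxA mulmxV // mul1mx.
  move=> a; rewrite /pair_T /E; case: ifP => _.
    have -> : \row_i lam 0 i = lam by apply/rowP => i; rewrite mxE.
    by rewrite mulmxA -XP -!mulmxA PM.
  have -> : diag_mx (\row_i (1 - lam 0 i)) = 1%:M - diag_mx lam.
    by apply/matrixP => i j; rewrite !mxE mulrnBl.
  by rewrite !mulmxBl mul1mx mulmxBr PM mulmxA -XP -!mulmxA PM.
apply: If; exists (M, E, P^T *m pi) => //; split=> /= i.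
  transitivity ((M *m ones K d) i 0); last by rewrite M1 mxE.
  by rewrite [RHS]mxE; apply: eq_bigr => j _; rewrite [X in _ * X]mxE mulr1.
by rewrite sum_letters /E eqxx (negPf a01) addrC subrK.
Qed.

End Field.
End TwoLetters.

Section Density.
Variables (Sigma : finType) (a0 a1 : Sigma).
Hypotheses (a01 : a1 != a0) (a01P : forall a, a = a0 \/ a = a1).
Variables (d n : nat) (K : numClosedFieldType) (f : Rn K Sigma n).
Hypothesis If : ideal_hidden_markov K Sigma d.+1 n f.
Variable pi : 'cV[K]_d.+1.

Let vanish (X S : 'M[K]_d.+1) :=
  peval (word_probs (pair_T a0 (X *m S) S) pi) f = 0.

Lemma path_pair_T (Y S : 'M[{poly K}]_d.+1) s :
  (fun a => map_mx (horner_eval s) (pair_T a0 Y S a)) =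
  pair_T a0 (map_mx (horner_eval s) Y) (map_mx (horner_eval s) S).
Proof. by apply: funext => a; rewrite map_pair_T. Qed.

Lemma horner_const_mx p q (A : 'M[K]_(p, q)) s :
  map_mx (horner_eval s) (map_mx polyC A) = A.
Proof. by apply/matrixP => i j; rewrite !mxE /horner_eval hornerC. Qed.

(** The columns of Q V^-1, with V the Newton matrix, are eigenvectors and add up to Q e_0, the
    all-ones vector. *)
Lemma vanish_bidiag_distinct (Q S : 'M[K]_d.+1) (lam : 'rV[K]_d.+1) :
  Q \in unitmx -> Q *m delta_mx 0 0 = ones K d.+1 -> S *m ones K d.+1 = ones K d.+1 ->
  \det (newton_mx lam) != 0 ->
  vanish (Q *m bidiag_mx lam *m invmx Q) S.
Proof.
rewrite -unitfE -unitmxE => uQ Q1 S1 uV.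
have V1 : invmx (newton_mx lam) *m ones K d.+1 = delta_mx 0 0.
  by rewrite -(newton_mx0 lam) mulKmx.
apply: (hidden_markov_conj a01 a01P If (P := Q *m invmx (newton_mx lam)) (lam := lam)) => //.
- by rewrite unitmx_mul uQ unitmx_inv.
- by rewrite -mulmxA V1.
rewrite mulmxA mulmxKV // -!mulmxA; congr (_ *m _).
rewrite -[LHS](mulKmx uV); congr (_ *m _).
by rewrite mulmxA newton_bidiag -mulmxA mulmxV // mulmx1.
Qed.

(** Moving only [lam] along lam + s * nodes, with [Q] fixed, makes the eigenvalues distinct. *)
Lemma vanish_bidiag (Q S : 'M[K]_d.+1) (lam : 'rV[K]_d.+1) :
  Q \in unitmx -> Q *m delta_mx 0 0 = ones K d.+1 -> S *m ones K d.+1 = ones K d.+1 ->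
  vanish (Q *m bidiag_mx lam *m invmx Q) S.
Proof.
move=> uQ Q1 S1.
pose L := line_mx lam (lam + nodes K d.+1).
pose X := map_mx polyC Q *m bidiag_mx L *m map_mx polyC (invmx Q).
have XE s : map_mx (horner_eval s) (X *m map_mx polyC S) =
    Q *m bidiag_mx (map_mx (horner_eval s) L) *m invmx Q *m S.
  by rewrite !map_mxM map_bidiag_mx !horner_const_mx.
have := @path_closed K Sigma d.+1 n (pair_T a0 (X *m map_mx polyC S) (map_mx polyC S))
  (map_mx polyC pi) f (\det (newton_mx L)).
move=> /(_ _ _ 0); rewrite path_pair_T XE !horner_const_mx horner_line_mx0; apply.
  rewrite det_newton; apply/prodf_neq0 => i _; apply/prodf_neq0 => j ji.
  (* The coefficient of s in lam_i - lam_j is a difference of two nodes. *)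
  apply/eqP => /polyP /(_ 1%N) /eqP; rewrite !mxE !coefE /=.
  by rewrite !add0r !mul1r !(addrC (lam 0 _)) !addrK subr_eq0 eqr_nat eqSS gtn_eqF.
move=> s; rewrite -[X in X -> _]/(is_true (horner_eval s _ != 0)) -det_map_mx map_newton_mx.
rewrite path_pair_T XE !horner_const_mx; exact: vanish_bidiag_distinct.
Qed.

(** The characteristic polynomial splits over [K]; its roots, possibly repeated, are the nodes of
    the Newton basis. *)
Lemma vanish_cyclic (X S : 'M[K]_d.+1) :
  krylov_mx X \in unitmx -> S *m ones K d.+1 = ones K d.+1 -> vanish X S.
Proof.
move=> uX S1.
have [r chX] := closed_field_poly_normal (char_poly X).
rewrite (monicP (char_poly_monic X)) scale1r in chX.
have size_r : size r = d.+1.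
  by have := size_char_poly X; rewrite chX size_prod_XsubC => -[].
have [|Q [uQ Q1 XQ]] := @cyclic_bidiag d K X (\row_i r`_i) _ uX.
  rewrite chX (big_nth 0) big_mkord size_r; apply: eq_bigr => i _.
  by rewrite mxE.
by rewrite -[X](mulmxK uQ) XQ; apply: vanish_bidiag.
Qed.

(** The line joins [X] to a diagonal matrix with distinct entries, whose Krylov matrix is a
    transposed Vandermonde matrix. *)
Lemma vanish_factored (X S : 'M[K]_d.+1) : S *m ones K d.+1 = ones K d.+1 -> vanish X S.
Proof.
move=> S1.
pose L := line_mx X (diag_mx (nodes K d.+1)).
have LE s : map_mx (horner_eval s) (L *m map_mx polyC S) =
    map_mx (horner_eval s) L *m S.
  by rewrite map_mxM horner_const_mx.
have := @path_closed K Sigma d.+1 n (pair_T a0 (L *m map_mx polyC S) (map_mx polyC S))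
  (map_mx polyC pi) f (\det (krylov_mx L)).
move=> /(_ _ _ 0); rewrite path_pair_T LE !horner_const_mx horner_line_mx0; apply.
  have : \det (krylov_mx (diag_mx (nodes K d.+1))) != 0.
    by rewrite krylov_diag det_tr -unitfE -unitmxE Vandermonde_nodes_unit.
  apply: contraNneq => /(congr1 (horner_eval 1)).
  by rewrite -det_map_mx map_krylov_mx horner_line_mx1 /horner_eval horner0 => ->.
move=> s; rewrite -[X in X -> _]/(is_true (horner_eval s _ != 0)) -det_map_mx map_krylov_mx.
rewrite path_pair_T LE !horner_const_mx -unitfE -unitmxE => uX.
exact: vanish_cyclic.
Qed.

(** All matrices on the line from [S] to the identity fix the all-ones vector; at the invertible
    ones [Y] factors as required. *)
Lemma vanish_finitary (Y S : 'M[K]_d.+1) : S *m ones K d.+1 = ones K d.+1 ->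
  peval (word_probs (pair_T a0 Y S) pi) f = 0.
Proof.
move=> S1; pose L := line_mx S 1%:M.
have := @path_closed K Sigma d.+1 n (pair_T a0 (map_mx polyC Y) L)
  (map_mx polyC pi) f (\det L).
move=> /(_ _ _ 0); rewrite path_pair_T !horner_const_mx horner_line_mx0; apply.
  apply/eqP => /(congr1 (horner_eval 1)) /eqP.
  by rewrite -det_map_mx horner_line_mx1 rmorph0 det1 oner_eq0.
move=> s; rewrite -[X in X -> _]/(is_true (horner_eval s _ != 0)) -det_map_mx.
rewrite path_pair_T !horner_const_mx -unitfE -unitmxE => uL.
rewrite -[Y](mulmxKV uL); apply: vanish_factored.
by rewrite horner_line_mx mulmxDl -scalemxAl mulmxBl mul1mx S1 subrr scaler0 addr0.
Qed.

End Density.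

Lemma hidden_markov_sub_finitary (K : numClosedFieldType) (Sigma : finType)
    (d n : nat) : (0 < d)%N -> #|Sigma| = 2%N ->
  ideal_hidden_markov K Sigma d n `<=` ideal_finitary K Sigma d n.
Proof.
case: d => // d _ /eqP; rewrite -cardsT => /cards2P [a0 [a1 [a01 E]]].
have a01P a : a = a0 \/ a = a1.
  have : a \in [set: Sigma]%SET by rewrite inE.
  by rewrite E !inE => /orP [] /eqP; [left|right].
rewrite eq_sym in a01; move=> f If _ [[T pi] /= T1 <-].
have ST : (\sum_a T a) *m ones K d.+1 = ones K d.+1 by rewrite mulmx_suml.
have := vanish_finitary a01 a01P If pi (T a0) ST.
suff -> : pair_T a0 (T a0) (\sum_a T a) = T by [].
apply: funext => a; rewrite /pair_T (sum_letters a01 a01P).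
by case: (a01P a) => ->; rewrite ?eqxx // (negPf a01) [T a0 + _]addrC addrK.
Qed.

(** * The empty alphabet and the final equalities *)

Lemma ideal_J_empty (A : comNzRingType) (Sigma : finType) (d n : nat) g :
  #|Sigma| = 0%N -> (0 < d)%N -> (0 < n)%N -> ideal_J A Sigma n d g -> g = 0.
Proof.
move=> Sigma0 d0 n0.
apply: (ideal_gen_kernel (phi := idfun)) => _ [r [c [_ _ ->]]] /=.
have noletter (a : Sigma) : False by have := fintype0 a Sigma0.
case: d d0 r c => // d _ r c; rewrite (expand_det_row _ 0) big1 // => j _.
rewrite mxE mxE /pword big1 ?mul0r // => -[[|a v] sv] _; last by case: (noletter a).
by exfalso; move: n0; rewrite -[in X in (_ < X)%N](eqP sv).
Qed.

(* The hypothesis hSigma excludes only one-letter alphabets with d >= 2, for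
   which the equality fails: all entries of the matrix defining J_{d,n} are then
   equal, so J_{d,n} = 0 and the quotient is R_n, while I_{M_d,n} = 0. *)
Theorem theorem6p10 (R : realType) (Sigma : finType) (d n : nat)
    (hd : (1 <= d)%N) (hn : (2 * d - 1 <= n)%N)
    (hSigma : #|Sigma| = 1%N -> d = 1%N) :
  ideal_finitary R[i] Sigma d n =
    ideal_quotient (radical (ideal_I R[i] Sigma n d.+1))
                   (ideal_J R[i] Sigma n d) /\
  (#|Sigma| = 2%N ->
   ideal_hidden_markov R[i] Sigma d n =
     ideal_quotient (radical (ideal_I R[i] Sigma n d.+1))
                    (ideal_J R[i] Sigma n d)).
Proof.
have finitaryE : ideal_finitary R[i] Sigma d n =
    ideal_quotient (radical (ideal_I R[i] Sigma n d.+1)) (ideal_J R[i] Sigma n d).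
  apply/seteqP; have [a0 _|none] := pickP (@predT Sigma); last first.
    (* Without letters both sides are the whole ring: J_{d,n} is zero, and the model is empty as 0
       differs from the all-ones vector. *)
    have noletter (a : Sigma) : False by have := none a.
    split=> f _.
      move=> g Jg; suff -> : g = 0.
        by rewrite mulr0; exists 1%N => //; rewrite expr1; apply: ideal_gen0.
      apply: ideal_J_empty Jg => //; last by lia.
      exact: eq_card0.
    move=> x [[T pi] /= Tfin _]; exfalso; move: Tfin.
    rewrite /finitary_model /= big1 => [/colP /(_ (Ordinal hd)) /eqP|a]; last by case: (noletter a).
    by rewrite !mxE eq_sym oner_eq0.
  split; first exact: finitary_sub_quotient.
  have [a1 a10|single] := pickP [pred a | a != a0].
    by apply: (quotient_sub_finitary (a0 := a0) (a1 := a1)) => //; left.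
  apply: (quotient_sub_finitary (a0 := a0) (a1 := a0)) => //; right; apply: hSigma.
  rewrite -(card1 a0); apply: eq_card => a; rewrite inE.
  by have /= := single a; rewrite inE => /negbFE ->.
split=> // Sigma2; rewrite -finitaryE; apply/seteqP; split.
  exact: hidden_markov_sub_finitary.
exact: finitary_sub_hidden_markov.
Qed.
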